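(* A Lorentzian metric tensor $g$ on the $3$-dimensional Heisenberg group $\mathbb{H}_3$ determines a $\mathbb{Z}_2^2$-symmetric Lorentzian structure on $\mathbb{H}_3$ (that is, there is a $\mathbb{Z}_2^2$-symmetric structure on $\mathbb{H}_3$ for which $g$ is a $\mathbb{Z}_2^2$-symmetric Lorentzian metric) if and only if $g$ is a left-invariant Lorentzian metric on $\mathbb{H}_3$.
   Context: $\mathbb{H}_3$ is the group of real upper triangular unipotent $3\times 3$ matrices, with Lie algebra $\mathfrak{h}_3$. A Lorentzian metric on an $n$-manifold is a smooth field of non-degenerate quadratic forms of signature $(n-1,1)$. A subgroup $\Gamma\subset \mathrm{Aut}(\mathfrak{h}_3)$ isomorphic to $\mathbb{Z}_2^2=(\mathbb{Z}/2\mathbb{Z})^2$ consists of commuting involutive automorphisms, and its simultaneous eigenspace decomposition is a $\mathbb{Z}_2^2$-grading $\mathfrak{h}_3=\bigoplus_{\gamma\in\mathbb{Z}_2^2}\mathfrak{g}_\gamma$ with $[\mathfrak{g}_\gamma,\mathfrak{g}_{\gamma'}]\subset\mathfrak{g}_{\gamma\gamma'}$, where $\mathfrak{g}_\epsilon$ ($\epsilon$ the unit of $\mathbb{Z}_2^2$) is the space of vectors fixed by $\Gamma$. A $\mathbb{Z}_2^2$-symmetric structure on $\mathbb{H}_3=\mathbb{H}_3/\{e\}$ is the structure given by such a grading (with $\mathfrak{g}_\epsilon=\{0\}$, so the isotropy subgroup $H$ is trivial). A $\mathbb{Z}_2^2$-symmetric Lorentzian metric for this structure is an $\mathbb{H}_3$-invariant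 (i.e. left-invariant) Lorentzian metric $g$, with associated bilinear form $B$ on $\mathfrak{h}_3$, such that one of the following holds: (1) the components $\mathfrak{g}_\gamma$, $\gamma\neq\epsilon$, are pairwise orthogonal and non-degenerate with respect to $B$; (2) one component $\mathfrak{g}_{\lambda_0}$, $\lambda_0\ne\epsilon$, is degenerate, the other components are orthogonal and non-degenerate, and there exists a component $\mathfrak{g}_{\lambda_1}$ such that the restriction of $B$ to $\mathfrak{g}_{\lambda_0}\oplus\mathfrak{g}_{\lambda_1}$ has signature $(1,1)$. *)

(* Defs.v *)
From HB Require Import structures.
From mathcomp Require Import all_boot all_order all_algebra.
From mathcomp Require Import all_classical all_reals all_analysis.

Set Implicit Arguments.
Unset Strict Implicit.
Unset Printing Implicit Defensive.

Import Order.TTheory GRing.Theory Num.Theory.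
Import numFieldNormedType.Exports.

Local Open Scope ring_scope.

(* H_3 is an affine subspace of 'M_3 with direction the Lie algebra h_3 of
   strictly upper triangular matrices, so every tangent space of H_3 is
   identified with h_3; the tangent vectors are not trivialised by left
   translations. *)

Definition unitri (R : realType) (p : 'M[R]_3) : bool :=
  [forall i : 'I_3, forall j : 'I_3, (j <= i)%N ==> (p i j == (i == j)%:R)].

Lemma unitriP (R : realType) (p : 'M[R]_3) :
  reflect (forall i j : 'I_3, (j <= i)%N -> p i j = (i == j)%:R) (unitri p).
Proof.
apply: (iffP forallP) => [h i j ji|h i].
  by have /forallP/(_ j) := h i; rewrite ji => /eqP.
by apply/forallP => j; apply/implyP => ji; rewrite h.
Qed.

Definition heis (R : realType) : Type := {p : 'M[R]_3 | unitri p}.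

Lemma unitri1 (R : realType) : unitri (1%:M : 'M[R]_3).
Proof. by apply/unitriP => i j _; rewrite mxE. Qed.

Lemma unitriM (R : realType) (a b : 'M[R]_3) :
  unitri a -> unitri b -> unitri (a *m b).
Proof.
move=> /unitriP ha /unitriP hb; apply/unitriP => i j ji.
rewrite mxE (bigD1 i) //= ha // eqxx mul1r hb // big1 ?addr0 // => k ki.
have [le_ki|lt_ik] := leqP k i; first by rewrite ha // eq_sym (negbTE ki) mul0r.
rewrite hb ?(leq_trans ji (ltnW lt_ik)) // (_ : (k == j) = false) ?mulr0 //.
by apply/negbTE; rewrite -val_eqE /= gtn_eqF // (leq_ltn_trans ji lt_ik).
Qed.

Definition heis1 (R : realType) : heis R := exist _ 1%:M (unitri1 R).

Definition heis_mul (R : realType) (a b : heis R) : heis R :=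
  exist _ (sval a *m sval b) (unitriM (svalP a) (svalP b)).

Definition h3_basis (R : realType) : 3.-tuple 'M[R]_3 :=
  [tuple delta_mx 0 1; delta_mx 1 2%:R; delta_mx 0 2%:R].

Definition h3 (R : realType) : {vspace 'M[R]_3} := <<h3_basis R>>%VS.

Notation h3T R := (subvs_of (h3 R)).

Lemma h3P (R : realType) (x : 'M[R]_3) :
  reflect (forall i j : 'I_3, (j <= i)%N -> x i j = 0) (x \in h3 R).
Proof.
apply: (iffP idP) => [/coord_span -> i j ji|h].
  rewrite !big_ord_recl big_ord0 /= !mxE.
  by move: i j ji => [[|[|[|//]]] ?] [[|[|[|//]]] ?] //= _; rewrite !mulr0 !addr0.
have -> : x = x 0 1 *: delta_mx 0 1 + x 1 2%:R *: delta_mx 1 2%:R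
              + x 0 2%:R *: delta_mx 0 2%:R.
  apply/matrixP => i j; rewrite !mxE.
  have [ji|] := leqP j i.
    rewrite h //.
    by move: i j ji => [[|[|[|//]]] ?] [[|[|[|//]]] ?] //= _; rewrite !mulr0 !addr0.
  by move: i j => [[|[|[|//]]] ?] [[|[|[|//]]] ?] //= _;
    rewrite ?mulr0 ?mulr1 ?addr0 ?add0r; congr (x _ _); apply: val_inj.
by rewrite !memvD ?memvZ ?memv_span // !inE eqxx ?orbT.
Qed.

(* vsproj is the ambient projection onto h3; the values it is applied to below
   already lie in h3 (lie_val, dleft_val). *)
Definition lie (R : realType) (x y : h3T R) : h3T R :=
  vsproj (h3 R) (vsval x *m vsval y - vsval y *m vsval x).

(* The differential at p of the left translation by a. *)
Definition dleft (R : realType) (a p : heis R) (v : h3T R) :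
    h3T R :=
  vsproj (h3 R) ('D_(vsval v) (fun q : 'M[R]_3 => sval a *m q) (sval p)).

Lemma lie_val (R : realType) (x y : h3T R) :
  vsval (lie x y) = vsval x *m vsval y - vsval y *m vsval x.
Proof.
rewrite vsprojK //; apply/h3P => i j ji.
have /h3P hx := subvsP x; have /h3P hy := subvsP y.
have mul0 (a b : 'M[R]_3) : (forall i j : 'I_3, (j <= i)%N -> a i j = 0) ->
    (forall i j : 'I_3, (j <= i)%N -> b i j = 0) -> (a *m b) i j = 0.
  move=> ha hb; rewrite mxE big1 // => k _.
  have [le_ki|lt_ik] := leqP k i; first by rewrite ha ?mul0r.
  by rewrite hb ?mulr0 // (leq_trans ji (ltnW lt_ik)).
have -> : (vsval x *m vsval y - vsval y *m vsval x) i j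
    = (vsval x *m vsval y) i j - (vsval y *m vsval x) i j by rewrite !mxE.
by rewrite !mul0 ?subrr.
Qed.

Lemma derive_mulmx (R : realType) (a p v : 'M[R]_3) :
  'D_v (fun q : 'M[R]_3 => a *m q) p = a *m v.
Proof.
rewrite /derive; apply: cvg_lim; first exact: norm_hausdorff.
apply: cvg_near_cst.
near=> h; rewrite /= mulmxDr addrK -scalemxAr scalerA mulVf ?scale1r //.
by near: h; exact: nbhs_dnbhs_neq.
Unshelve. all: by end_near. Qed.

Lemma dleft_val (R : realType) (a p : heis R) (v : h3T R) :
  vsval (dleft a p v) = sval a *m vsval v.
Proof.
rewrite vsprojK derive_mulmx //; apply/h3P => i j ji.
have /h3P hv := subvsP v; have /unitriP ha := svalP a.
rewrite mxE big1 // => k _.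
have [le_ik|lt_ki] := leqP i k; first by rewrite hv ?mulr0 // (leq_trans ji).
by rewrite ha ?(ltnW lt_ki) // -val_eqE gtn_eqF // mul0r.
Qed.

Lemma unitri_coord (R : realType) (u : 'rV[R]_3) :
  unitri (1%:M + \sum_i u 0 i *: tnth (h3_basis R) i).
Proof.
have : \sum_i u 0 i *: tnth (h3_basis R) i \in h3 R.
  by apply: memv_suml => i _; rewrite memvZ ?memv_span ?mem_tnth.
by move=> /h3P h; apply/unitriP => i j ji; rewrite mxE h // addr0 mxE.
Qed.

(* A global chart of H_3. *)
Definition heis_coord (R : realType) (u : 'rV[R]_3) : heis R :=
  exist (@unitri R) _ (unitri_coord u).

Fixpoint Ck (R : realType) (k : nat) (f : 'rV[R]_3 -> R) : Prop :=
  match k with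
  | 0 => continuous f
  | k'.+1 => continuous f /\ forall i : 'I_3,
      (forall u, derivable f u (delta_mx 0 i)) /\
      Ck k' (fun u => 'D_(delta_mx 0 i) f u)
  end.

Section Forms.
Variables (R : realType) (V : vectType R).
Implicit Types (B : {symmetric V}) (U : {vspace V}).

Definition orthogonal_spaces B U U' : Prop := (U <= orthov B U')%VS.

Definition nondegenerate_on B U : Prop := (U :&: orthov B U)%VS = 0%VS.

(* p positive and q negative squares in an orthogonal basis of U, as in
   Sylvester's law of inertia. *)
Definition signature_on B U (p q : nat) : Prop :=
  exists e : (p + q).-tuple V,
    basis_of U e /\
    forall i j : 'I_(p + q), B (tnth e i) (tnth e j) =
      if i == j then (if (i < p)%N then 1 else -1) else 0.

End Forms.

Definition tensor_field (R : realType) : Type :=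
  heis R -> {symmetric (h3T R)}.

Definition lorentzian_metric (R : realType) (g : tensor_field R) : Prop :=
  (forall (v w : h3T R) (k : nat),
     Ck k (fun u => g (heis_coord u) v w)) /\
  (forall p, nondegenerate (g p) /\ signature_on (g p) fullv 2 1).

Definition left_invariant (R : realType) (g : tensor_field R) : Prop :=
  forall (a p : heis R) (v w : h3T R),
    g (heis_mul a p) (dleft a p v) (dleft a p w) = g p v w.

Definition lie_automorphism (R : realType) (f : 'End(h3T R)) : Prop :=
  lker f = 0%VS /\ forall x y, f (lie x y) = lie (f x) (f y).

(* Z_2^2 is written additively, with unit 0.  A subgroup of Aut(h_3) isomorphic
   to Z_2^2 is given by an injective morphism rho : Z_2^2 -> Aut(h_3). *)
Notation Z22 := ('Z_2 * 'Z_2)%type.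

Definition Z22_automorphisms (R : realType)
    (rho : Z22 -> 'End(h3T R)) : Prop :=
  [/\ injective rho,
      forall a, lie_automorphism (rho a) &
      forall a b : Z22, rho (a + b) = (rho a \o rho b)%VF].

(* The grading group is identified with the character group of Z_2^2 through the
   pairing (-1)^(a1 c1 + a2 c2). *)
Definition Z22_char (R : realType) (c a : Z22) : R :=
  (-1) ^+ ((a.1 * c.1 + a.2 * c.2)%R : 'Z_2).

Definition component (R : realType) (rho : Z22 -> 'End(h3T R))
    (c : Z22) : {vspace (h3T R)} :=
  (\bigcap_(a : Z22) passmx.leigenspace (rho a) (Z22_char R c a))%VS.

Definition Z22_symmetric_structure (R : realType)
    (rho : Z22 -> 'End(h3T R)) : Prop :=
  Z22_automorphisms rho /\ component rho 0 = 0%VS.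

Definition orthogonal_grading (R : realType)
    (rho : Z22 -> 'End(h3T R))
    (B : {symmetric (h3T R)}) : Prop :=
  (forall c d : Z22, c != 0 -> d != 0 -> c != d ->
     orthogonal_spaces B (component rho c) (component rho d)) /\
  (forall c : Z22, c != 0 -> nondegenerate_on B (component rho c)).

Definition degenerate_grading (R : realType)
    (rho : Z22 -> 'End(h3T R))
    (B : {symmetric (h3T R)}) : Prop :=
  exists l0 : Z22,
  [/\ l0 != 0,
      ~ nondegenerate_on B (component rho l0),
      forall c d : Z22, c != 0 -> d != 0 -> c != l0 -> d != l0 ->
        c != d -> orthogonal_spaces B (component rho c) (component rho d),
      forall c : Z22, c != 0 -> c != l0 ->
        nondegenerate_on B (component rho c) &
      exists l1 : Z22, l1 != l0 /\
        signature_on B (component rho l0 + component rho l1)%VS 1 1].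

Definition Z22_symmetric_lorentzian (R : realType)
    (rho : Z22 -> 'End(h3T R)) (g : tensor_field R) : Prop :=
  [/\ lorentzian_metric g, left_invariant g &
      orthogonal_grading rho (g (heis1 R)) \/
      degenerate_grading rho (g (heis1 R))].

(* Main.v *)
From HB Require Import structures.
Require Import Defs.
From mathcomp Require Import all_boot all_order all_algebra.
From mathcomp Require Import all_classical all_reals all_analysis.
From mathcomp Require Import ring.

(** The automorphisms of h_3 act on the quotient by the center, and on the
    center by the determinant of that action.  Hence if x and y span a
    complement of the center, spanned by z, then scaling x and y by two signs
    and z by their product is an automorphism; these sign changes form a group
    Z_2^2, and the nonzero components of the grading are the lines <x>, <y>,
    <z>.  So a grading may be prescribed by any basis (x, y, z) of h_3 whose
    last vector is central, and the theorem reduces to linear algebra: a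
    nondegenerate symmetric form B on h_3 must have such a basis adapted to it.

    If B z z is nonzero, the plane orthogonal to z is nondegenerate and any
    orthogonal basis (x, y) of it gives an orthogonal grading
    ([orthogonal_basis_through]).  If B z z = 0, a vector dual to z can be
    corrected by a multiple of z into x with B x x = B x z = 1; then x and z
    span a hyperbolic plane and y is taken in its orthogonal
    ([hyperbolic_basis_through]), which gives a degenerate grading.  Both cases
    rest on [complete_plane]: in dimension 3, a nondegenerate plane is completed
    to a basis by an orthogonal vector, which cannot be isotropic.
    The converse holds because left invariance is part of the definition of a
    Z_2^2-symmetric metric. *)

Set Implicit Arguments.
Unset Strict Implicit.
Unset Printing Implicit Defensive.

Import Order.TTheory GRing.Theory Num.Theory.

Local Open Scope ring_scope.

(** * Bases adapted to a symmetric form and a line *)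

Section SymmetricForm.
Variables (R : realType) (V : vectType R) (B : {symmetric V}).
Implicit Types u v w z : V.

Lemma symmC u v : B u v = B v u.
Proof. by rewrite hermC expr0 mul1r. Qed.

Lemma symmZl a u v : B (a *: u) v = a * B u v.
Proof. by rewrite linearZl_LR. Qed.
Lemma symmZr a u v : B u (a *: v) = a * B u v.
Proof. by rewrite symmC symmZl symmC. Qed.

Lemma symmDl u v w : B (u + v) w = B u w + B v w.
Proof. exact: linearDl. Qed.
Lemma symmDr u v w : B w (u + v) = B w u + B w v.
Proof. exact: linearD. Qed.
Lemma symmNl u w : B (- u) w = - B u w.
Proof. exact: linearNl. Qed.
Lemma symmNr u w : B w (- u) = - B w u.
Proof. exact: linearN. Qed.

Definition symmE := (symmDl, symmNl, symmDr, symmNr, symmZl, symmZr).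

Lemma orthogonal_tuple_free n (X : n.-tuple V) :
  (forall i j, i != j -> B (tnth X i) (tnth X j) = 0) ->
  (forall i, B (tnth X i) (tnth X i) != 0) -> free X.
Proof.
move=> BX0 BXX; apply/freeP => k kX0 i.
have : B (\sum_j k j *: X`_j) X`_i = 0 by rewrite kX0 linear0l.
rewrite linear_sumlz (bigD1 i) //= big1 => [|j ji].
  rewrite addr0 symmZl -tnth_nth => /eqP.
  by rewrite mulf_eq0 (negPf (BXX i)) orbF => /eqP.
by rewrite symmZl -!tnth_nth BX0 // mulr0.
Qed.

Lemma nondegenerate_dual u : nondegenerate B -> u != 0 -> exists w, B u w != 0.
Proof.
move=> /eqP ndB; rewrite -memv0 -ndB => /mem_orthovPn[w _ uw].
by exists w.
Qed.

Lemma exists_orthogonal2 u v : (2 < \dim {:V})%N ->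
  exists2 w, w != 0 & B w u = 0 /\ B w v = 0.
Proof.
move=> dimV; pose W := (orthov B <[u]> :&: orthov B <[v]>)%VS.
have dimW : (0 < \dim W)%N.
  have := leq_dim_orthov1 B u fullv; rewrite capfv => du.
  apply: leq_trans (leq_dim_orthov1 B v _).
  move: dimV du; case: (\dim fullv) => [|[|[|n]]] //= _.
  by case: (\dim _) => [|[|m]].
exists (vpick W); first by rewrite vpick0 -dimv_eq0 -lt0n.
have /memv_capP[] := memv_pick W.
by rewrite !mem_orthov1 => /eqP-> /eqP->.
Qed.

(** The Gram determinant makes the plane spanned by u and v meet its orthogonal
    trivially, so any nonzero w orthogonal to u and v completes them to a basis;
    if w were isotropic it would be orthogonal to this whole basis. *)
Lemma complete_plane u v :
  nondegenerate B -> \dim {:V} = 3 -> B u u * B v v - B u v ^+ 2 != 0 ->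
  exists w, [/\ B w u = 0, B w v = 0, B w w != 0 &
    basis_of fullv [tuple u; v; w]].
Proof.
move=> ndB dimV gram; have [|w w0 [wu wv]] := @exists_orthogonal2 u v.
  by rewrite dimV.
have bX : basis_of fullv [tuple u; v; w].
  rewrite basisEfree subvf dimV andbT.
  apply/freeP => k; rewrite !big_ord_recl big_ord0 /= addr0.
  set a := k _; set b := k _; set c := k _ => rel.
  have relu : a * B u u + b * B u v = 0.
    have : B (a *: u + (b *: v + c *: w)) u = 0 by rewrite rel linear0l.
    by rewrite !symmE wu mulr0 addr0 (symmC v).
  have relv : a * B u v + b * B v v = 0.
    have : B (a *: u + (b *: v + c *: w)) v = 0 by rewrite rel linear0l.
    by rewrite !symmE wv mulr0 addr0.
  (* Cramer's rule for the system relu, relv. *)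
  have a0 : a = 0.
    apply/eqP; rewrite -(mulIr_eq0 _ (mulIf gram)); apply/eqP.
    transitivity ((a * B u u + b * B u v) * B v v
                  - (a * B u v + b * B v v) * B u v); first by ring.
    by rewrite relu relv !mul0r subr0.
  have b0 : b = 0.
    apply/eqP; rewrite -(mulIr_eq0 _ (mulIf gram)); apply/eqP.
    transitivity ((a * B u v + b * B v v) * B u u
                  - (a * B u u + b * B u v) * B u v); first by ring.
    by rewrite relu relv !mul0r subr0.
  have c0 : c = 0.
    move/eqP: rel; rewrite a0 b0 !scale0r !add0r scaler_eq0 (negPf w0) orbF.
    by move/eqP.
  by case=> [[|[|[|//]]] ?];
    [rewrite -[RHS]a0|rewrite -[RHS]b0|rewrite -[RHS]c0];
    congr k; apply: val_inj.
exists w; split=> //; apply: contraNneq w0 => ww.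
rewrite -memv0 -(eqP ndB); apply/mem_orthovP => x _.
rewrite (coord_basis bX (memvf x)) !big_ord_recl big_ord0 /= addr0.
by rewrite !symmE wu wv ww !mulr0 !addr0.
Qed.

(** Some vector y orthogonal to z is not isotropic, by polarization; the plane
    spanned by y and z is then nondegenerate, and [complete_plane] gives x. *)
Lemma orthogonal_basis_through z :
  nondegenerate B -> \dim {:V} = 3 -> B z z != 0 ->
  exists x y, [/\ B x y = 0, B x z = 0, B y z = 0, B x x != 0 /\ B y y != 0 &
    basis_of fullv [tuple x; y; z]].
Proof.
move=> ndB dimV zz.
have [y yz yy] : exists2 y, B y z = 0 & B y y != 0.
  have [|v v0 [vz _]] := @exists_orthogonal2 z z; first by rewrite dimV.
  have [w vw] := nondegenerate_dual ndB v0.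
  have [vv|?] := eqVneq (B v v) 0; last by exists v.
  (* The projection of w along z, still paired nontrivially with v. *)
  pose w' := w - (B w z / B z z) *: z.
  have w'z : B w' z = 0 by rewrite /w' !symmE divfK // subrr.
  have vw' : B v w' = B v w by rewrite /w' !symmE vz mulr0 subr0.
  move: w' w'z vw' => w' w'z vw'.
  have [ww|?] := eqVneq (B w' w') 0; last by exists w'.
  exists (v + w'); first by rewrite !symmE vz w'z addr0.
  rewrite symmDl !symmDr vv ww add0r addr0 (symmC w') vw'.
  by rewrite -mulr2n mulrn_eq0.
have [|x [xy xz xx bX]] := @complete_plane y z ndB dimV.
  by rewrite yz expr0n subr0 mulf_neq0.
exists x, y; split=> //.
rewrite (perm_basis (Y := [tuple y; z; x])) //=.
by rewrite -[[:: x; y; z]]/([:: x] ++ [:: y; z]) perm_catC.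
Qed.

(** Adding a multiple of the isotropic vector z to a vector v with B v z = 1
    changes B v v by any prescribed amount and preserves B v z.  The plane of
    the resulting x and z has Gram determinant -1. *)
Lemma hyperbolic_basis_through z :
  nondegenerate B -> \dim {:V} = 3 -> z != 0 -> B z z = 0 ->
  exists x y, [/\ B x y = 0, B x z = 1, B y z = 0, B x x = 1 /\ B y y != 0 &
    basis_of fullv [tuple x; y; z]].
Proof.
move=> ndB dimV z0 zz; have [w zw] := nondegenerate_dual ndB z0.
have [v vz] : exists v, B v z = 1.
  by exists ((B z w)^-1 *: w); rewrite symmZl (symmC w) mulVf.
have [x xz xx] : exists2 x, B x z = 1 & B x x = 1.
  exists (v + ((1 - B v v) / 2) *: z); rewrite !symmE vz zz ?mulr0 ?addr0 //.
  by rewrite (symmC z) vz; field.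
have [|y [yx yz yy bX]] := @complete_plane x z ndB dimV.
  by rewrite zz xz mulr0 sub0r expr1n oppr_eq0 oner_neq0.
exists x, y; split=> //; first by rewrite symmC.
rewrite (perm_basis (Y := [tuple x; z; y])) //=.
by rewrite perm_cons -[[:: y; z]]/([:: y] ++ [:: z]) perm_catC.
Qed.

Lemma hyperbolic_signature x z : B x x = 1 -> B x z = 1 -> B z z = 0 ->
  signature_on B (<[z]> + <[x]>)%VS 1 1.
Proof.
move=> xx xz zz; have zx : B z x = 1 by rewrite symmC.
have gram (i j : 'I_2) : B (tnth [tuple x; x - z] i) (tnth [tuple x; x - z] j)
    = if i == j then (if (i < 1)%N then 1 else -1) else 0.
  by case: i j => [[|[|//]] ?] [[|[|//]] ?]; rewrite !(tnth_nth 0) /= ?symmE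
    xx ?xz ?zx ?zz ?subrr ?subr0 ?sub0r.
(* The orthogonal basis is (x, x - z): B x (x - z) = 1 - 1, and
   B (x - z) (x - z) = 1 - 2. *)
exists [tuple x; x - z]; split; last exact: gram.
rewrite /basis_of.
rewrite (@orthogonal_tuple_free 2) ?andbT => [|i j /negPf ij|i]; last 2 first.
- by rewrite gram ij.
- by rewrite gram eqxx; case: ifP; rewrite ?oppr_eq0 oner_neq0.
rewrite span_cons span_seq1 eqEsubv !subv_add -!memvE.
have xU : x \in (<[z]> + <[x]>)%VS by rewrite memvE addvSr.
have zU : z \in (<[z]> + <[x]>)%VS by rewrite memvE addvSl.
have xW : x \in (<[x]> + <[x - z]>)%VS by rewrite memvE addvSl.
have xzW : x - z \in (<[x]> + <[x - z]>)%VS by rewrite memvE addvSr.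
rewrite xU memvB //= xW andbT.
by have := memvB xW xzW; rewrite subKr.
Qed.

End SymmetricForm.

(** * Endomorphisms diagonal in a basis *)

Section Diagonal.
Variables (R : realType) (V : vectType R) (n : nat) (b : n.-tuple V).
Implicit Types (t : 'I_n -> R) (v : V).

Definition diag_fun t v := \sum_i (t i * coord b i v) *: b`_i.

Lemma diag_fun_linear t : linear (diag_fun t).
Proof.
move=> a u v; rewrite /diag_fun scaler_sumr -big_split.
apply: eq_bigr => i _ /=.
by rewrite linearP /= scalerA -scalerDl; congr (_ *: _); ring.
Qed.

HB.instance Definition _ t :=
  GRing.isLinear.Build R V V _ (diag_fun t) (diag_fun_linear t).

Definition diag_end t : 'End(V) := linfun (diag_fun t).

Hypothesis bX : basis_of fullv b.

Lemma coord_diag t v i : coord b i (diag_end t v) = t i * coord b i v.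
Proof. by rewrite lfunE coord_sum_free // (basis_free bX). Qed.

Lemma coord_inj u v : (forall i, coord b i u = coord b i v) -> u = v.
Proof.
move=> uv; rewrite (coord_basis bX (memvf u)) (coord_basis bX (memvf v)).
by apply: eq_bigr => i _; rewrite uv.
Qed.

Lemma diag_comp s t :
  (diag_end s \o diag_end t)%VF = diag_end (fun i => s i * t i).
Proof.
apply/lfunP => v; rewrite comp_lfunE; apply: coord_inj => i.
by rewrite !coord_diag mulrA.
Qed.

Lemma diag_inj s t : diag_end s = diag_end t -> s =1 t.
Proof.
move=> st i; have := coord_diag t b`_i i; rewrite -st coord_diag.
by rewrite coord_free ?(basis_free bX) // eqxx !mulr1.
Qed.

Lemma lker_diag t : (forall i, t i != 0) -> lker (diag_end t) = 0%VS.
Proof.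
move=> t0; apply/eqP/lker0P => u v uv; apply: coord_inj => i.
by apply: (mulfI (t0 i)); rewrite -!coord_diag uv.
Qed.

End Diagonal.

(** * Characters of Z_2^2 *)

Section Characters.
Variable R : realType.

Lemma Z22_charMr (c a b : Z22) :
  Z22_char R c (a + b) = Z22_char R c a * Z22_char R c b.
Proof.
move: c a b => [[[|[|//]] ?] [[|[|//]] ?]] [[[|[|//]] ?] [[|[|//]] ?]]
  [[[|[|//]] ?] [[|[|//]] ?]];
  by rewrite /Z22_char /= ?expr0 ?expr1 ?mulr1 ?mul1r ?mulrNN ?mulr1.
Qed.

Lemma Z22_charC (c a : Z22) : Z22_char R c a = Z22_char R a c.
Proof. by rewrite /Z22_char mulrC [a.2 * _]mulrC. Qed.

Lemma Z22_charMl (c d a : Z22) :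
  Z22_char R (c + d) a = Z22_char R c a * Z22_char R d a.
Proof. by rewrite !(Z22_charC _ a) Z22_charMr. Qed.

Lemma Z22_char_neq0 (c a : Z22) : Z22_char R c a != 0.
Proof. by rewrite expf_neq0 // oppr_eq0 oner_neq0. Qed.

Lemma Z22_char_inj : injective (Z22_char R).
Proof.
have char10 c : Z22_char R c (1, 0) = (-1) ^+ (c.1 : 'Z_2).
  by case: c => [[[|[|//]] ?] [[|[|//]] ?]].
have char01 c : Z22_char R c (0, 1) = (-1) ^+ (c.2 : 'Z_2).
  by case: c => [[[|[|//]] ?] [[|[|//]] ?]].
have sgn (k l : 'Z_2) : (-1) ^+ k = (-1) ^+ l :> R -> k = l.
  have m1 : (1 == -1 :> R) = false.
    by rewrite eq_sym eqNr oner_eq0.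
  move: k l => [[|[|//]] ?] [[|[|//]] ?] /= /eqP;
    rewrite ?expr0 ?expr1 ?m1 1?[-1 == 1]eq_sym ?m1 // => _; exact: val_inj.
move=> c d cd.
have /sgn e1 : (-1) ^+ (c.1 : 'Z_2) = (-1) ^+ (d.1 : 'Z_2) :> R.
  by rewrite -!char10 cd.
have /sgn e2 : (-1) ^+ (c.2 : 'Z_2) = (-1) ^+ (d.2 : 'Z_2) :> R.
  by rewrite -!char01 cd.
by rewrite [c]surjective_pairing [d]surjective_pairing e1 e2.
Qed.

End Characters.

(** * Gradings of h_3 *)

Section Heisenberg.
Variable R : realType.
Local Notation V := (h3T R).

Definition h3_center : V := vsproj (h3 R) (delta_mx 0 2%:R).

Lemma h3_center_val : vsval h3_center = delta_mx 0 2%:R.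
Proof. by rewrite vsprojK // memv_span // !inE eqxx !orbT. Qed.

Definition symplectic (u v : V) : R :=
  vsval u 0 1 * vsval v 1 2%:R - vsval v 0 1 * vsval u 1 2%:R.

Lemma lieE u v : lie u v = symplectic u v *: h3_center.
Proof.
apply: (can_inj vsvalK); rewrite lie_val linearZ /= h3_center_val /symplectic.
have l1 : lift ord0 ord0 = 1 :> 'I_3 by apply: val_inj.
have l2 : lift ord0 (lift ord0 ord0) = 2%:R :> 'I_3 by apply: val_inj.
have ord3P (P : 'I_3 -> Prop) : P ord0 -> P 1 -> P 2%:R -> forall i, P i.
  move=> P0 P1 P2 [[|[|[|//]]] lt_i]; [move: P0|move: P1|move: P2];
    by congr P; apply: val_inj.
have strict (w : V) := (fun i j le_ji => (h3P _ (subvsP w)) i j le_ji).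
have low (w : V) := (strict w ord0 ord0 isT, strict w 1 ord0 isT,
  strict w 1 1 isT, strict w 2%:R ord0 isT, strict w 2%:R 1 isT,
  strict w 2%:R 2%:R isT).
apply/matrixP; apply: (ord3P _); apply: (ord3P _);
  rewrite !mxE !big_ord_recl !big_ord0 l1 l2 !low /=; ring.
Qed.

Lemma symplectic_comb x y (p q : 'I_3 -> R) :
  symplectic (p 0 *: x + (p 1 *: y + p 2%:R *: h3_center))
             (q 0 *: x + (q 1 *: y + q 2%:R *: h3_center))
  = (p 0 * q 1 - p 1 * q 0) * symplectic x y.
Proof.
have vsval_comb (r : 'I_3 -> R) :
    vsval (r 0 *: x + (r 1 *: y + r 2%:R *: h3_center))
  = r 0 *: vsval x + (r 1 *: vsval y + r 2%:R *: delta_mx 0 2%:R).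
  by rewrite !linearD !linearZ /= h3_center_val.
by rewrite /symplectic !vsval_comb !mxE /=; ring.
Qed.

(** The form [symplectic] comes from the plane h_3 / center, where the diagonal
    map multiplies it by the determinant t 0 * t 1; this must match the
    eigenvalue t 2 on the center, where brackets lie. *)
Lemma diag_lie (b : 3.-tuple V) (t : 'I_3 -> R) u v :
  basis_of fullv b -> b`_2 = h3_center -> t 0 * t 1 = t 2%:R ->
  diag_end b t (lie u v) = lie (diag_end b t u) (diag_end b t v).
Proof.
move=> bX b2 t2.
have l1 : lift ord0 ord0 = 1 :> 'I_3 by apply: val_inj.
have l2 : lift ord0 (lift ord0 ord0) = 2%:R :> 'I_3 by apply: val_inj.
have expand w : w = coord b 0 w *: b`_0
    + (coord b 1 w *: b`_1 + coord b 2%:R w *: h3_center).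
  by rewrite {1}(coord_basis bX (memvf w)) !big_ord_recl big_ord0 l1 l2 /= b2
    addr0.
have symplecticE w w' : symplectic w w'
    = (coord b 0 w * coord b 1 w' - coord b 1 w * coord b 0 w')
      * symplectic b`_0 b`_1.
  rewrite {1}(expand w) {1}(expand w').
  exact: (symplectic_comb _ _ (coord b ^~ w) (coord b ^~ w')).
rewrite !lieE linearZ /=.
have -> : diag_end b t h3_center = t 2%:R *: h3_center.
  apply: (coord_inj bX) => i; rewrite coord_diag // linearZ /= -b2.
  rewrite [coord b i b`_2](coord_free (2%:R : 'I_3) i) ?(basis_free bX) //.
  by case: eqP => [<-|]; rewrite ?mulr0.
rewrite scalerA !(symplecticE (diag_end _ _ _)) (symplecticE u).
rewrite !coord_diag // -t2.
by congr (_ *: _); ring.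
Qed.

(** The degrees of the basis vectors: the third is the sum of the other two, as
    the bracket requires, and together they exhaust the nonzero elements. *)
Definition weight (i : 'I_3) : Z22 := tnth [tuple (1, 0); (0, 1); (1, 1)] i.

Lemma weight_neq0 i : weight i != 0.
Proof. by move: i => [[|[|[|//]]] ?]. Qed.

Lemma weight_inj : injective weight.
Proof. by move=> [[|[|[|//]]] ?] [[|[|[|//]]] ?] // _; apply: val_inj. Qed.

Lemma weight_surj (c : Z22) : c != 0 -> exists i, c = weight i.
Proof.
move: c => [[[|[|//]] p] [[|[|//]] q]] // _;
  [exists 1|exists 0|exists 2%:R]; congr pair; exact: val_inj.
Qed.

Definition grading (b : 3.-tuple V) (a : Z22) : 'End(V) :=
  diag_end b (fun i => Z22_char R (weight i) a).

Lemma nondegenerate_on_line (B : {symmetric V}) (v : V) :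
  v != 0 -> nondegenerate_on B <[v]> <-> B v v != 0.
Proof.
move=> v0; rewrite /nondegenerate_on; split => [nd|vv].
  apply: contraNneq v0 => vv; rewrite -memv0 -nd memv_cap memv_line.
  by rewrite mem_orthov1 vv eqxx.
apply/eqP; rewrite -subv0; apply/subvP => u /memv_capP[/vlineP[k ->]].
rewrite mem_orthov1 symmZl mulf_eq0 (negPf vv) orbF => /eqP->.
by rewrite scale0r mem0v.
Qed.

Section Grading.
Variable b : 3.-tuple V.
Hypothesis bX : basis_of fullv b.

Lemma grading_automorphisms : b`_2 = h3_center -> Z22_automorphisms (grading b).
Proof.
move=> b2; split=> [a a' aa'|a|a a'].
- have e i : Z22_char R (weight i) a = Z22_char R (weight i) a'.
    by have := diag_inj bX aa' i.
  apply: (@Z22_char_inj R); apply/funext => c.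
  have [->|/weight_surj[i ->]] := eqVneq c 0.
    by rewrite /Z22_char !mul0r.
  by rewrite !(Z22_charC _ _ (weight i)).
- split; first by apply: lker_diag => // i; exact: Z22_char_neq0.
  move=> u v; apply: diag_lie => //.
  rewrite -Z22_charMl; congr Z22_char.
- rewrite /grading diag_comp //; congr diag_end; apply/funext => i.
  exact: Z22_charMr.
Qed.

(** On the line of b_i the group acts by the character of [weight i], and
    distinct elements of Z_2^2 have distinct characters. *)
Lemma mem_component c v :
  (v \in component (grading b) c) =
  [forall i, (coord b i v == 0) || (weight i == c)].
Proof.
have memP : reflect (forall a, grading b a v = Z22_char R c a *: v)
    (v \in component (grading b) c).
  apply: (iffP idP) => [vc a|eig].
    apply/eqP; rewrite -subr_eq0; move: vc; rewrite /component memvE.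
    move=> /subv_bigcapP/(_ a isT); rewrite -memvE memv_ker.
    by rewrite add_lfunE opp_lfunE scale_lfunE id_lfunE.
  rewrite memvE; apply/subv_bigcapP => a _; rewrite -memvE memv_ker.
  by rewrite add_lfunE opp_lfunE scale_lfunE id_lfunE eig subrr.
apply/memP/forallP => [eig i|h a].
  rewrite orbC; apply: contraT; rewrite negb_or => /andP[wic vi].
  case/eqP: wic; apply: (@Z22_char_inj R); apply/funext => a.
  apply: (mulIf vi); have := congr1 (coord b i) (eig a).
  by rewrite coord_diag // linearZ.
apply: (coord_inj bX) => i; rewrite coord_diag // linearZ /=.
by have /orP[/eqP->|/eqP->] := h i; rewrite ?mulr0.
Qed.

Lemma component0 : component (grading b) 0 = 0%VS.
Proof.
apply/eqP; rewrite -subv0; apply/subvP => v; rewrite mem_component memv0.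
move=> /forallP h; apply/eqP; apply: (coord_inj bX) => i; rewrite linear0.
by have := h i; rewrite (negPf (weight_neq0 i)) orbF => /eqP.
Qed.

Lemma component_weight i : component (grading b) (weight i) = <[b`_i]>%VS.
Proof.
apply/vspaceP => v; rewrite mem_component; apply/forallP/vlineP => [h|[k ->] j].
  exists (coord b i v); apply: (coord_inj bX) => j.
  rewrite linearZ /= coord_free ?(basis_free bX) //.
  have := h j; rewrite (inj_eq weight_inj).
  by have [->|] := eqVneq j i; rewrite ?mulr1 //= orbF mulr0 => _ /eqP.
rewrite linearZ /= coord_free ?(basis_free bX) // (inj_eq weight_inj).
by have [_|] := eqVneq i j; rewrite ?orbT //= mulr0 eqxx.
Qed.

Lemma grading_structure :
  b`_2 = h3_center -> Z22_symmetric_structure (grading b).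
Proof. by split; [exact: grading_automorphisms|exact: component0]. Qed.

Lemma nondegenerate_component (B : {symmetric V}) i :
  nondegenerate_on B (component (grading b) (weight i)) <-> B b`_i b`_i != 0.
Proof.
rewrite component_weight; apply: nondegenerate_on_line.
by rewrite (basis_not0 bX) // mem_nth // size_tuple.
Qed.

Lemma orthogonal_grading_of_gram (B : {symmetric V}) :
  (forall i j : 'I_3, i != j -> B b`_i b`_j = 0) ->
  (forall i : 'I_3, B b`_i b`_i != 0) ->
  orthogonal_grading (grading b) B.
Proof.
move=> B0 BN; split=> [_ _ /weight_surj[i ->] /weight_surj[j ->]|].
  rewrite (inj_eq weight_inj) => ij.
  by rewrite /orthogonal_spaces !component_weight orthov11 B0.
by move=> _ /weight_surj[i ->]; exact: (nondegenerate_component B i).2.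
Qed.

(** The central line <b_2> is the degenerate component; <b_0> is the one that
    forms a hyperbolic plane with it. *)
Lemma degenerate_grading_of_gram (B : {symmetric V}) :
  B b`_0 b`_0 = 1 -> B b`_0 b`_1 = 0 -> B b`_0 b`_2 = 1 ->
  B b`_1 b`_1 != 0 -> B b`_2 b`_2 = 0 -> degenerate_grading (grading b) B.
Proof.
move=> xx xy xz yy zz; exists (weight 2%:R); split.
- exact: weight_neq0.
- by move/(nondegenerate_component B 2%:R).1; rewrite /= zz eqxx.
- move=> _ _ /weight_surj[i ->] /weight_surj[j ->].
  rewrite !(inj_eq weight_inj) /orthogonal_spaces !component_weight orthov11.
  move: i j => [[|[|[|//]]] ?] [[|[|[|//]]] ?] //= _ _ _;
    by rewrite ?xy // symmC xy.
- move=> _ /weight_surj[i ->]; rewrite (inj_eq weight_inj) => i2.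
  apply: (nondegenerate_component B i).2.
  by case: i i2 => [[|[|[|//]]] ?] //= _; rewrite xx oner_neq0.
exists (weight 0); split=> //.
by rewrite !component_weight; exact: hyperbolic_signature.
Qed.

End Grading.

Lemma adapted_basis (B : {symmetric V}) :
  nondegenerate B -> \dim {:V} = 3 ->
  exists b : 3.-tuple V, [/\ basis_of fullv b, b`_2 = h3_center &
    orthogonal_grading (grading b) B \/ degenerate_grading (grading b) B].
Proof.
move=> ndB dimV; pose z := h3_center.
have z0 : z != 0.
  apply/eqP => /(congr1 (fun v : V => vsval v 0 2%:R)).
  by rewrite h3_center_val linear0 !mxE /= => /eqP; rewrite oner_eq0.
have [zz|zz] := eqVneq (B z z) 0.
  have [x [y [xy xz yz [xx yy] bX]]] := hyperbolic_basis_through ndB dimV z0 zz.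
  exists [tuple x; y; z]; split=> //; right.
  exact: (degenerate_grading_of_gram bX).
have [x [y [xy xz yz [xx yy] bX]]] := orthogonal_basis_through ndB dimV zz.
exists [tuple x; y; z]; split=> //; left.
apply: (orthogonal_grading_of_gram bX) => [i j|i].
  move: i j => [[|[|[|//]]] ?] [[|[|[|//]]] ?] //= _;
    by rewrite ?xy ?xz ?yz // symmC ?xy ?xz ?yz.
by case: i => [[|[|[|//]]] ?].
Qed.

End Heisenberg.

Theorem corollary23 (R : realType) (g : tensor_field R)
    (hg : lorentzian_metric g) :
  (exists rho : Z22 -> 'End(h3T R),
     Z22_symmetric_structure rho /\ Z22_symmetric_lorentzian rho g)
  <-> (lorentzian_metric g /\ left_invariant g).
Proof.
split=> [[rho [_ []]] //|[_ linv]].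
have [ndB [e [eX _]]] := hg.2 (heis1 R).
have [b [bX b2 ogr]] := adapted_basis ndB (size_basis eX).
by exists (grading b); split; [exact: grading_structure|split].
Qed.
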